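(* Let $\{X_k\}\subset\mathbb{R}^{r\times r_+}$ be a sequence such that $\{f(X_k)\}$ is descending (i.e. $f(X_{k+1})\le f(X_k)$ for all $k$) and $\lim_{k\to\infty}\nabla f(X_k)=0$. Suppose that $\limsup_{k\to\infty}\|X_k\|_2\le 1$, that there is a constant $\alpha\in(0,1)$ such that $f(X_k)<\frac{\alpha^2}{4}$, and that for all sufficiently large $k$, $$\lambda\|(WX_k)_-\|_F^2\le \alpha\,\|X_kX_k^T-I_r\|_F-\|X_kX_k^T-I_r\|_F^2 .$$ Then any accumulation point $X_\infty$ of $\{X_k\}$ is a globally optimal solution of $\min_{X\in\mathbb{R}^{r\times r_+}}f(X)$.
   Context: $A\in\mathbb{R}^{n\times n}$ is a completely positive matrix, i.e. $A=BB^T$ for some entrywise nonnegative matrix $B$; $r=\mathrm{rank}(A)$; the cp-rank $r_{cp}(A)$ is the smallest possible number of columns of such a $B$. $A=WW^T$ is a factorization with $W\in\mathbb{R}^{n\times r}$ of full column rank, $r_+\ge r_{cp}(A)$ is an integer, and $\lambda>0$. For a real matrix $Z$, $Z_-=\min\{Z,0\}$ (entrywise) denotes its negative part; $\|\cdot\|_F$ is the Frobenius norm and $\|\cdot\|_2$ the spectral norm. The function $f:\mathbb{R}^{r\times r_+}\to\mathbb{R}$ is $$f(X)=\tfrac14\|XX^T-I_r\|_F^2+\tfrac{\lambda}{2}\|(WX)_-\|_F^2 .$$ It is continuously differentiable with $\nabla f(X)=(XX^T-I_r)X+\lambda W^T(WX)_-$. The condition $f(X_k)<\alpha^2/4$ is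 understood for all $k$. *)

(* Defs.v *)
From HB Require Import structures.
From mathcomp Require Export all_boot all_order all_algebra.
From mathcomp Require Export all_classical all_reals all_analysis.
Export Order.TTheory GRing.Theory Num.Theory.
Export numFieldNormedType.Exports.

Set Implicit Arguments.
Unset Strict Implicit.
Unset Printing Implicit Defensive.

Local Open Scope classical_set_scope.
Local Open Scope ring_scope.

Definition mx_nonneg (R : realType) (m n : nat) (B : 'M[R]_(m, n)) : Prop :=
  forall i j, 0 <= B i j.

Definition has_cp_factor (R : realType) (n : nat) (A : 'M[R]_n) (k : nat) : Prop :=
  exists B : 'M[R]_(n, k), mx_nonneg B /\ A = B *m B^T.

Definition completely_positive (R : realType) (n : nat) (A : 'M[R]_n) : Prop :=
  exists k : nat, has_cp_factor A k.

Lemma completely_positive_asbool (R : realType) (n : nat) (A : 'M[R]_n) :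
  completely_positive A -> exists k, `[< has_cp_factor A k >].
Proof. by move=> [k Ak]; exists k; apply/asboolP. Qed.

Definition cp_rank (R : realType) (n : nat) (A : 'M[R]_n)
    (cpA : completely_positive A) : nat :=
  ex_minn (completely_positive_asbool cpA).

(* The norm `|A| that the library puts on matrices is the max norm, hence the
   two norms below; the topology is the usual one in either case. *)
Definition frobenius_norm (R : realType) (m n : nat) (A : 'M[R]_(m, n)) : R :=
  Num.sqrt (\sum_(i < m) \sum_(j < n) A i j ^+ 2).

(* Operator norm induced by the Euclidean norms, the Euclidean norm of a column
   vector being its Frobenius norm; the set is nonempty and bounded, so that
   its real-valued sup is a genuine supremum. *)
Definition spectral_norm (R : realType) (m n : nat) (A : 'M[R]_(m, n)) : R :=
  sup [set frobenius_norm (A *m v) | v in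
         [set v : 'cV[R]_n | frobenius_norm v <= 1]].

Definition mx_neg_part (R : realType) (m n : nat) (Z : 'M[R]_(m, n)) :
    'M[R]_(m, n) :=
  map_mx (fun z => Num.min z 0) Z.

(* Matrix of partial derivatives, i.e. the gradient with respect to the
   Frobenius inner product when g is differentiable. *)
Definition mx_gradient (R : realType) (m n : nat) (g : 'M[R]_(m, n) -> R)
    (X : 'M[R]_(m, n)) : 'M[R]_(m, n) :=
  \matrix_(i, j) 'D_(delta_mx i j) g X.

Definition cp_objective (R : realType) (n r rp : nat) (W : 'M[R]_(n, r))
    (lambda : R) (X : 'M[R]_(r, rp)) : R :=
  4^-1 * frobenius_norm (X *m X^T - 1%:M) ^+ 2
  + lambda / 2 * frobenius_norm (mx_neg_part (W *m X)) ^+ 2.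

Definition global_minimizer (R : realType) (T : Type) (g : T -> R) (x : T) : Prop :=
  forall y, g x <= g y.

(* Main.v *)
From mathcomp Require Import ring lra.
Require Import Defs.

(** The limit point [Xoo] is shown to have objective value [0], which is the
    global minimum since the objective is nonnegative.

    Write [f] for the objective, [E := Xoo Xoo^T - 1], [delta := |E|_F] and
    [neg := lambda * |(W Xoo)_-|_F ^ 2]. Three
    closed conditions pass from the sequence to [Xoo] ([cluster_le]): the
    gradient vanishes, [|Xoo v| <= |v|] for all [v] ([cluster_contraction]), and
    [neg <= alpha * delta - delta ^ 2].

    Pairing the vanishing gradient with [Xoo] gives the identity
    [delta ^ 2 + neg = \tr (1 - Xoo Xoo^T)] ([mxtrace_cp_gradient]). As [Xoo] is
    a contraction, [1 - Xoo Xoo^T] is positive semidefinite, and the trace of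
    such a matrix dominates its Frobenius norm
    ([frobenius_norm_le_mxtrace_1B]); thus [delta <= delta ^ 2 + neg]. Together
    with the third condition, [delta <= alpha * delta], so [delta = 0] because
    [alpha < 1], then [neg <= 0], and [f Xoo = 0].

    The remaining work is to identify the matrix of partial derivatives with
    the closed formula [cp_gradient], which is done by bounding the first-order
    remainder of [f] along lines. *)

Set Implicit Arguments.
Unset Strict Implicit.
Unset Printing Implicit Defensive.

Local Open Scope classical_set_scope.
Local Open Scope ring_scope.

(** * Frobenius inner product and positive semidefinite matrices *)

(** [\tr (A *m B^T)] is the Frobenius inner product; the proofs below compute with
    it, since cyclicity of the trace moves factors across it. *)
Lemma mxtrace_mul_tr (R : realType) (m n : nat) (A B : 'M[R]_(m, n)) :
  \tr (A *m B^T) = \sum_(i < m) \sum_(j < n) A i j * B i j.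
Proof.
by apply: eq_bigr => i _; rewrite mxE; apply: eq_bigr => j _; rewrite mxE.
Qed.

Lemma mxtrace_mul_trC (R : realType) (m n : nat) (A B : 'M[R]_(m, n)) :
  \tr (A *m B^T) = \tr (B *m A^T).
Proof. by rewrite -mxtrace_tr trmx_mul trmxK. Qed.

Lemma sqr_frobenius_norm (R : realType) (m n : nat) (A : 'M[R]_(m, n)) :
  frobenius_norm A ^+ 2 = \tr (A *m A^T).
Proof.
rewrite mxtrace_mul_tr sqr_sqrtr; last first.
  by apply: sumr_ge0 => i _; apply: sumr_ge0 => j _; exact: sqr_ge0.
by apply: eq_bigr => i _; apply: eq_bigr => j _; rewrite expr2.
Qed.

Lemma frobenius_norm_ge0 (R : realType) (m n : nat) (A : 'M[R]_(m, n)) :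
  0 <= frobenius_norm A.
Proof. exact: sqrtr_ge0. Qed.

Lemma mxtrace_mul_tr_ge0 (R : realType) (m n : nat) (A : 'M[R]_(m, n)) :
  0 <= \tr (A *m A^T).
Proof. by rewrite -sqr_frobenius_norm sqr_ge0. Qed.

Lemma trmx_gram_sub1 (R : realType) (m n : nat) (X : 'M[R]_(m, n)) :
  (X *m X^T - 1%:M)^T = X *m X^T - 1%:M.
Proof. by rewrite linearB/= trmx_mul trmxK trmx1. Qed.

Lemma mxtraceB (R : realType) (n : nat) (A B : 'M[R]_n) :
  \tr (A - B) = \tr A - \tr B.
Proof. exact: raddfB. Qed.

Lemma mxtrace_mul_trD (R : realType) (m n : nat) (A B : 'M[R]_(m, n)) :
  \tr ((A + B) *m (A + B)^T)
    = \tr (A *m A^T) + 2 * \tr (A *m B^T) + \tr (B *m B^T).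
Proof.
rewrite [(_ + _)^T]raddfD/= mulmxDl !mulmxDr !mxtraceD.
rewrite [\tr (B *m A^T)]mxtrace_mul_trC; ring.
Qed.

Lemma mxtrace_mul_trB (R : realType) (m n : nat) (A B : 'M[R]_(m, n)) :
  \tr ((A - B) *m (A - B)^T)
    = \tr (A *m A^T) - 2 * \tr (A *m B^T) + \tr (B *m B^T).
Proof.
rewrite mxtrace_mul_trD [(- B)^T]raddfN/= !mulmxN mulNmx opprK.
by rewrite [\tr (- _)]raddfN/= mulrN.
Qed.

Lemma frobenius_normZ (R : realType) (m n : nat) (a : R) (A : 'M[R]_(m, n)) :
  0 <= a -> frobenius_norm (a *: A) = a * frobenius_norm A.
Proof.
move=> a0; apply/eqP.
rewrite -(@eqrXn2 _ 2) ?mulr_ge0 ?frobenius_norm_ge0// exprMn.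
rewrite !sqr_frobenius_norm [(_ *: _)^T]linearZ/= -scalemxAl -scalemxAr.
by rewrite !mxtraceZ mulrA.
Qed.

Lemma frobenius_norm_le1 (R : realType) (m n : nat) (A : 'M[R]_(m, n)) :
  (frobenius_norm A <= 1) = (\tr (A *m A^T) <= 1).
Proof.
by rewrite -sqr_frobenius_norm expr_le1// frobenius_norm_ge0.
Qed.

(** The discriminant inequality in homogeneous form. The point [(c, - b)]
    settles [0 < c]; for [c = 0], positivity along [(b, t)] with [t] below
    [- a / 2] forces [b = 0]. *)
Lemma sqr_le_of_form_ge0 (R : realType) (a b c : R) :
  (forall s t, 0 <= s ^+ 2 * a + 2 * s * t * b + t ^+ 2 * c) -> b ^+ 2 <= a * c.
Proof.
move=> H.
have a0 : 0 <= a by have := H 1 0; lra.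
have c0 : 0 <= c by have := H 0 1; lra.
have [c_gt0|/eqP/esym c_eq0] : 0 < c \/ c == 0.
  by move: c0; rewrite le_eqVlt => /orP[/eqP <-|->]; [right|left].
- have := H c (- b).
  have -> : c ^+ 2 * a + 2 * c * - b * b + (- b) ^+ 2 * c
    = c * (a * c - b ^+ 2) by ring.
  by rewrite pmulr_rge0// subr_ge0.
- have := H b (- a - 1); rewrite -c_eq0.
  nra.
Qed.

(** Positivity of the 2 x 2 principal minors, [S i j ^+ 2 <= S i i * S j j],
    summed over [i] and [j] gives [(\tr S) ^+ 2] on the right. This replaces the
    comparison of the l2 and l1 norms of the eigenvalues, so no diagonalization
    is involved. *)
Lemma psd_frobenius_norm_le_mxtrace (R : realType) (n : nat) (S : 'M[R]_n) :
  S^T = S -> (forall u : 'cV[R]_n, 0 <= \tr (u^T *m S *m u)) ->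
  frobenius_norm S <= \tr S.
Proof.
move=> symS psdS.
have diag i j : (delta_mx i 0 : 'cV[R]_n)^T *m S *m (delta_mx j 0 : 'cV[R]_n)
    = (S i j)%:M.
  apply/matrixP => a b; rewrite !ord1 trmx_delta -rowE -colE !mxE eqxx.
  by rewrite mulr1n.
have symSE i j : S j i = S i j by rewrite -[in RHS]symS mxE.
have minor i j : S i j ^+ 2 <= S i i * S j j.
  apply: sqr_le_of_form_ge0 => s t.
  have := psdS (s *: delta_mx i 0 + t *: delta_mx j 0).
  rewrite [(_ + _)^T]linearD/= ![(_ *: _)^T]linearZ/= !mulmxDl !mulmxDr.
  rewrite -!scalemxAl -!scalemxAr.
  by rewrite !diag !mxtraceD !mxtraceZ !mxtrace_scalar !mulr1n (symSE i j); lra.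
have trS : 0 <= \tr S.
  apply: sumr_ge0 => i _; have := psdS (delta_mx i 0).
  by rewrite diag mxtrace_scalar mulr1n.
rewrite -[leRHS](ger0_norm trS) -sqrtr_sqr ler_wsqrtr// expr2 mulr_suml.
apply: ler_sum => i _; rewrite mulr_sumr; apply: ler_sum => j _; exact: minor.
Qed.

(** With [w := X^T *m u], expand [|u - X w|^2 >= 0]: the cross term
    [<u, X w>] is [|w|^2], and [|X w|^2 <= |w|^2]. *)
Lemma contraction_trmx (R : realType) (m n : nat) (X : 'M[R]_(m, n)) :
  (forall v : 'cV[R]_n, \tr ((X *m v) *m (X *m v)^T) <= \tr (v *m v^T)) ->
  forall u : 'cV[R]_m, \tr ((X^T *m u) *m (X^T *m u)^T) <= \tr (u *m u^T).
Proof.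
move=> contrX u; set w := X^T *m u.
have := mxtrace_mul_tr_ge0 (u - X *m w); have := contrX w.
have cross : \tr (u *m (X *m w)^T) = \tr (w *m w^T).
  by rewrite trmx_mul mulmxA mxtrace_mulC mulmxA.
rewrite mxtrace_mul_trB cross; lra.
Qed.

(** Contractivity of [X^T] says that [1 - X X^T] is positive semidefinite,
    which is how a spectral norm bound turns into a trace inequality. *)
Lemma frobenius_norm_le_mxtrace_1B (R : realType) (m n : nat) (X : 'M[R]_(m, n)) :
  (forall v : 'cV[R]_n, \tr ((X *m v) *m (X *m v)^T) <= \tr (v *m v^T)) ->
  frobenius_norm (X *m X^T - 1%:M) <= \tr (1%:M - X *m X^T).
Proof.
move=> /contraction_trmx contrXT.
have -> : frobenius_norm (X *m X^T - 1%:M) = frobenius_norm (1%:M - X *m X^T).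
  congr Num.sqrt; apply: eq_bigr => i _; apply: eq_bigr => j _.
  by rewrite -opprB mxE sqrrN.
apply: psd_frobenius_norm_le_mxtrace => [|u].
  by rewrite linearB/= trmx_mul trmxK trmx1.
have := contrXT u.
rewrite -subr_ge0 mulmxBr mulmx1 mulmxBl mxtraceB [\tr (u *m _)]mxtrace_mulC.
by rewrite [\tr (X^T *m u *m _)]mxtrace_mulC trmx_mul trmxK !mulmxA.
Qed.

(** The content is that the supremum defining [spectral_norm A] is over a
    bounded set: [|A w| <= |A|_F] on the unit ball. *)
Lemma frobenius_norm_mulmx_le_spectral_norm (R : realType) (m n : nat)
    (A : 'M[R]_(m, n)) (v : 'cV[R]_n) :
  \tr (v *m v^T) <= 1 -> frobenius_norm (A *m v) <= spectral_norm A.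
Proof.
move=> v1; apply: ub_le_sup; last first.
  by exists v => //=; rewrite frobenius_norm_le1.
exists (frobenius_norm A) => _ [w /= + <-]; rewrite frobenius_norm_le1 => w1.
rewrite -[leLHS](ger0_norm (frobenius_norm_ge0 _)).
rewrite -[leRHS](ger0_norm (frobenius_norm_ge0 _)) -!sqrtr_sqr ler_wsqrtr//.
rewrite !sqr_frobenius_norm; set y := A *m w.
(* [<A, y w^T> = |y|^2], so [0 <= |A - y w^T|^2 <= |A|^2 - |y|^2] as [|w| <= 1]. *)
have := mxtrace_mul_tr_ge0 (A - y *m w^T).
have cross : \tr (A *m (y *m w^T)^T) = \tr (y *m y^T).
  by rewrite trmx_mul trmxK mulmxA.
have prod : \tr (y *m w^T *m (y *m w^T)^T) = \tr (y *m y^T) * \tr (w *m w^T).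
  rewrite trmx_mul trmxK mulmxA -(mulmxA y) (mx11_scalar (w^T *m w)).
  rewrite mul_mx_scalar -scalemxAl mxtraceZ mulrC; congr (_ * _).
  by rewrite [in RHS]mxtrace_mulC [in RHS]/mxtrace big_ord1.
rewrite mxtrace_mul_trB cross prod.
have := mxtrace_mul_tr_ge0 y.
nra.
Qed.

(** * Passing to an accumulation point *)

Lemma near_lt_of_limn_esup_le (R : realType) (u : nat -> R) (c e : R) :
  (limn_esup (fun k => (u k)%:E) <= c%:E)%E -> 0 < e ->
  \forall k \near \oo, u k < c + e.
Proof.
move=> uc e0.
have : (limn_esup (fun k => (u k)%:E) < (c + e)%:E)%E.
  by apply: le_lt_trans uc _; rewrite lte_fin ltrDl.
rewrite /limn_esup limf_esupE => /ereal_inf_lt[_ [V Voo <-] supV].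
near=> k; rewrite -lte_fin; apply: le_lt_trans supV.
apply: ereal_sup_ubound; exists k => //.
by near: k; exact: Voo.
Unshelve. all: by end_near. Qed.

(** How each condition on the sequence is carried to an accumulation point:
    closed sublevel sets are stable under clustering, so no convergent
    subsequence has to be extracted. *)
Lemma cluster_le (R : realType) (T : topologicalType) (F : set_system T)
    (g : T -> R) (c : R) (x : T) :
  continuous g -> cluster F x -> F [set y | g y <= c] -> g x <= c.
Proof.
move=> g_cont; rewrite clusterE => Fx Fc.
have gc_closed : closed [set y | g y <= c].
  by apply: preimage_closed (closed_le (y := c)) => y _; exact: g_cont.
by have := Fx _ Fc; rewrite -(iffLR (closure_id _) gc_closed).
Qed.

(** Working entry by entry reduces continuity of products of rectangular
    matrices to that of finite sums of products of real functions. *)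
Definition entrywise_continuous (R : realType) (T : topologicalType) (m n : nat)
    (F : T -> 'M[R]_(m, n)) : Prop :=
  forall i j, continuous (fun t => F t i j : R).

Lemma continuous_bigsum (R : realType) (T : topologicalType)
    (I : finType) (f : I -> T -> R) :
  (forall i, continuous (f i)) -> continuous (fun t => \sum_i f i t).
Proof.
move=> fc t; apply: cvg_big => [|i _]; last exact: fc.
exact: add_continuous.
Qed.

Lemma entrywise_continuous_cst (R : realType) (T : topologicalType)
    (m n : nat) (A : 'M[R]_(m, n)) :
  entrywise_continuous (fun _ : T => A).
Proof. by move=> i j t; exact: cvg_cst. Qed.

Lemma entrywise_continuous_tr (R : realType) (T : topologicalType)
    (m n : nat) (F : T -> 'M[R]_(m, n)) :
  entrywise_continuous F -> entrywise_continuous (fun t => (F t)^T).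
Proof.
move=> Fc i j.
by rewrite (_ : (fun _ => _) = fun t => F t j i)//; apply/funext => t; rewrite mxE.
Qed.

Lemma entrywise_continuousD (R : realType) (T : topologicalType)
    (m n : nat) (F G : T -> 'M[R]_(m, n)) :
  entrywise_continuous F -> entrywise_continuous G ->
  entrywise_continuous (fun t => F t + G t).
Proof.
move=> Fc Gc i j t.
rewrite (_ : (fun _ => _) = fun s => F s i j + G s i j); last first.
  by apply/funext => s; rewrite mxE.
by apply: cvgD; [exact: Fc|exact: Gc].
Qed.

Lemma entrywise_continuousM (R : realType) (T : topologicalType)
    (m n p : nat) (F : T -> 'M[R]_(m, n))
    (G : T -> 'M[R]_(n, p)) :
  entrywise_continuous F -> entrywise_continuous G ->
  entrywise_continuous (fun t => F t *m G t).
Proof.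
move=> Fc Gc i j.
rewrite (_ : (fun _ => _) = fun s => \sum_k F s i k * G s k j); last first.
  by apply/funext => s; rewrite mxE.
by apply: continuous_bigsum => k t; apply: cvgM; [exact: Fc|exact: Gc].
Qed.

Lemma entrywise_continuousZ (R : realType) (T : topologicalType)
    (m n : nat) (a : R) (F : T -> 'M[R]_(m, n)) :
  entrywise_continuous F -> entrywise_continuous (fun t => a *: F t).
Proof.
move=> Fc i j t.
rewrite (_ : (fun _ => _) = fun s => a * F s i j); last first.
  by apply/funext => s; rewrite mxE.
by apply: cvgM; [exact: cvg_cst|exact: Fc].
Qed.

Lemma entrywise_continuous_neg_part (R : realType) (T : topologicalType)
    (m n : nat) (F : T -> 'M[R]_(m, n)) :
  entrywise_continuous F -> entrywise_continuous (fun t => mx_neg_part (F t)).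
Proof.
move=> Fc i j t.
rewrite (_ : (fun _ => _) = (fun s => F s i j) \min cst 0); last first.
  by apply/funext => s; rewrite mxE.
by apply: continuous_min; [exact: Fc|exact: cvg_cst].
Qed.

Lemma continuous_frobenius_norm (R : realType) (T : topologicalType)
    (m n : nat) (F : T -> 'M[R]_(m, n)) :
  entrywise_continuous F -> continuous (fun t => frobenius_norm (F t)).
Proof.
move=> Fc t; apply: (@continuous_comp _ _ _ _ Num.sqrt); last exact: sqrt_continuous.
apply: continuous_bigsum => i; apply: continuous_bigsum => j s.
rewrite (_ : (fun _ => _) = fun s => F s i j * F s i j); last first.
  by apply/funext => u; rewrite expr2.
by apply: cvgM; exact: Fc.
Qed.

(** * The gradient of the objective *)

(** A uniform quadratic remainder determines a directional derivative. Both
    terms of the objective have explicit remainders, which avoids the product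
    and chain rules for matrix-valued maps and the kink of [min z 0]. *)
Lemma is_derive_of_sqr_remainder (R : realType) (V : normedModType R)
    (f : V -> R) (x v : V) (l c : R) :
  (forall h : R, `|h| <= 1 -> `|f (h *: v + x) - f x - h * l| <= c * h ^+ 2) ->
  is_derive x v f l.
Proof.
move=> rem.
have dq_cvg : (fun h : R => h^-1 *: ((f \o shift x) (h *: v) - f x)) @ 0^' --> l.
  have c0 : 0 <= c.
    by have := rem 1; rewrite normr1 lexx expr1n mulr1 => /(_ isT); exact: le_trans.
  apply/cvgrPdist_le => e e0.
  near=> h.
  have h0 : h != 0 by near: h; exact: nbhs_dnbhs_neq.
  have h_gt0 : 0 < `|h| by rewrite normr_gt0.
  have -> : l - h^-1 *: ((f \o shift x) (h *: v) - f x)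
      = - h^-1 * (f (h *: v + x) - f x - h * l).
    by rewrite /= /shift/= -[_ *: _]/(_ * _); field.
  rewrite normrM normrN normfV ler_pdivrMl//.
  apply: (le_trans (rem h _)).
    by near: h; exact: dnbhs0_le.
  have : `|h| <= e / (c + 1).
    by near: h; apply: dnbhs0_le; rewrite divr_gt0// ltr_wpDl.
  rewrite ler_pdivlMr ?ltr_wpDl// => he.
  rewrite -(ger0_norm (sqr_ge0 h)) normrX expr2 mulrCA ler_pM2l//.
  by rewrite mulrC; apply: le_trans he; rewrite ler_wpM2l// lerDl.
by split; [apply/cvg_ex; exists l | exact: cvg_lim dq_cvg].
Unshelve. all: by end_near. Qed.

(** Along a line the residual is [E + h K + h^2 Q], so its squared norm is a
    quartic in [h] whose linear coefficient is [2 <E, K>]. *)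
Lemma is_derive_sqr_frobenius_gram (R : realType) (m n : nat)
    (X V : 'M[R]_(m, n)) :
  is_derive X V (fun Y => frobenius_norm (Y *m Y^T - 1%:M) ^+ 2)
    (4 * \tr ((X *m X^T - 1%:M) *m X *m V^T)).
Proof.
set E := X *m X^T - 1%:M; set K := V *m X^T + X *m V^T; set Q := V *m V^T.
set a := \tr (K *m K^T) + 2 * \tr (E *m Q^T).
set b := 2 * \tr (K *m Q^T); set d := \tr (Q *m Q^T).
have symE : E^T = E by exact: trmx_gram_sub1.
have EK : \tr (E *m K^T) = 2 * \tr (E *m X *m V^T).
  rewrite /K [(_ + _)^T]raddfD/= !trmx_mul !trmxK mulmxDr mxtraceD !mulmxA.
  suff -> : \tr (E *m V *m X^T) = \tr (E *m X *m V^T) by ring.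
  by rewrite mxtrace_mul_trC trmx_mul symE mulmxA mxtrace_mulC mulmxA.
apply: (@is_derive_of_sqr_remainder _ _ _ _ _ _ (`|a| + `|b| + `|d|)) => h h1.
have -> : (h *: V + X) *m (h *: V + X)^T - 1%:M = E + (h *: K + h ^+ 2 *: Q).
  rewrite [(_ + _)^T]raddfD/= [(_ *: _)^T]linearZ/= mulmxDl !mulmxDr.
  rewrite -!scalemxAl -!scalemxAr scalerA -expr2 /E /K /Q scalerDr.
  move: (h ^+ 2 *: _) (h *: (V *m X^T)) (h *: _) (X *m _) => p q s t.
  by apply/matrixP => i j; rewrite !mxE; ring.
rewrite !sqr_frobenius_norm !mxtrace_mul_trD.
rewrite [(_ + _)^T]raddfD/= ![(_ *: _)^T]linearZ/= mulmxDr mxtraceD.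
rewrite -!scalemxAl -!scalemxAr -?scalemxAl !mxtraceZ EK.
rewrite (_ : _ - _ - _ = h ^+ 2 * (a + h * b + h ^+ 2 * d)); last first.
  rewrite /a /b /d; ring.
rewrite normrM ger0_norm ?sqr_ge0// mulrC ler_wpM2r ?sqr_ge0//.
apply: (le_trans (ler_normD _ _)); apply: lerD.
  apply: (le_trans (ler_normD _ _)); rewrite lerD2l normrM.
  by rewrite ler_piMl.
by rewrite normrM normrX ler_piMl// exprn_ile1.
Qed.

(** [min z 0 ^+ 2] is C^1 with 2-Lipschitz derivative [2 * min z 0] and convex,
    hence its first-order remainder lies between [0] and [d ^+ 2]. *)
Lemma sqr_min0_remainder (R : realType) (z d : R) :
  0 <= Num.min (z + d) 0 ^+ 2 - Num.min z 0 ^+ 2 - 2 * d * Num.min z 0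
    <= d ^+ 2.
Proof. by apply/andP; split; case: (leP z 0) => ?; case: (leP (z + d) 0) => ?; nra. Qed.

Lemma is_derive_sqr_frobenius_neg_part (R : realType) (n r rp : nat)
    (W : 'M[R]_(n, r)) (X V : 'M[R]_(r, rp)) :
  is_derive X V (fun Y => frobenius_norm (mx_neg_part (W *m Y)) ^+ 2)
    (2 * \tr (W^T *m mx_neg_part (W *m X) *m V^T)).
Proof.
have -> : \tr (W^T *m mx_neg_part (W *m X) *m V^T)
    = \tr (mx_neg_part (W *m X) *m (W *m V)^T).
  by rewrite -mulmxA mxtrace_mulC trmx_mul mulmxA.
apply: (@is_derive_of_sqr_remainder _ _ _ _ _ _ (\tr ((W *m V) *m (W *m V)^T))).
move=> h _.
rewrite mulmxDr -scalemxAr !sqr_frobenius_norm !mxtrace_mul_tr.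
rewrite mulrA !mulr_sumr mulr_suml -!sumrB.
apply: (le_trans (ler_norm_sum _ _ _)); apply: ler_sum => i _.
rewrite !mulr_sumr mulr_suml -!sumrB.
apply: (le_trans (ler_norm_sum _ _ _)); apply: ler_sum => j _.
rewrite !mxE addrC; set z := \sum_(k < r) _; set y := \sum_(k < r) _.
have := sqr_min0_remainder z (h * y).
rewrite ler_norml => /andP[l u]; lra.
Qed.

Definition cp_gradient (R : realType) (n r rp : nat) (W : 'M[R]_(n, r))
    (lambda : R) (X : 'M[R]_(r, rp)) : 'M[R]_(r, rp) :=
  (X *m X^T - 1%:M) *m X + lambda *: (W^T *m mx_neg_part (W *m X)).

Lemma mxtrace_mul_tr_delta (R : realType) (m n : nat) (A : 'M[R]_(m, n)) i j :
  \tr (A *m (delta_mx i j)^T) = A i j.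
Proof.
rewrite mxtrace_mul_tr (bigD1 i)//= (bigD1 j)//= big1 => [|b bj].
  rewrite big1 => [|a ai].
    by rewrite [delta_mx _ _ _ _]mxE !eqxx mulr1 !addr0.
  by apply: big1 => b _; rewrite [delta_mx _ _ _ _]mxE (negPf ai) mulr0.
by rewrite [delta_mx _ _ _ _]mxE eqxx (negPf bj) mulr0.
Qed.

Lemma mx_gradient_cp_objective (R : realType) (n r rp : nat)
    (W : 'M[R]_(n, r)) (lambda : R) (X : 'M[R]_(r, rp)) :
  mx_gradient (cp_objective W lambda) X = cp_gradient W lambda X.
Proof.
apply/matrixP => i j; rewrite mxE; set V := delta_mx i j.
have dF := is_derive_sqr_frobenius_gram X V.
have dN := is_derive_sqr_frobenius_neg_part W X V.
have := is_deriveD (is_deriveZ 4^-1 dF) (is_deriveZ (lambda / 2) dN).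
move=> /(@derive_val _ _ _ _ _ _ _) dE.
transitivity (\tr (cp_gradient W lambda X *m V^T)).
  rewrite /cp_gradient mulmxDl mxtraceD -scalemxAl mxtraceZ.
  transitivity (4^-1 * (4 * \tr ((X *m X^T - 1%:M) *m X *m V^T))
    + lambda / 2 * (2 * \tr (W^T *m mx_neg_part (W *m X) *m V^T))) => //.
  by field.
exact: mxtrace_mul_tr_delta.
Qed.

Lemma mxtrace_mul_neg_part (R : realType) (m n : nat) (Z : 'M[R]_(m, n)) :
  \tr (mx_neg_part Z *m Z^T) = frobenius_norm (mx_neg_part Z) ^+ 2.
Proof.
rewrite sqr_frobenius_norm !mxtrace_mul_tr.
apply: eq_bigr => i _; apply: eq_bigr => j _; rewrite mxE.
by case: leP; rewrite ?mul0r.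
Qed.

(** The inner product of the gradient with the point itself: with
    [E := X X^T - 1], one has [<E X, X> = \tr (E (E + 1)) = |E|^2 + \tr E], and
    [<(W X)_-, W X> = |(W X)_-|^2] because a negative part is orthogonal to the
    positive part. *)
Lemma mxtrace_cp_gradient (R : realType) (n r rp : nat)
    (W : 'M[R]_(n, r)) (lambda : R) (X : 'M[R]_(r, rp)) :
  \tr (cp_gradient W lambda X *m X^T)
    = frobenius_norm (X *m X^T - 1%:M) ^+ 2
      + lambda * frobenius_norm (mx_neg_part (W *m X)) ^+ 2
      - \tr (1%:M - X *m X^T).
Proof.
rewrite -mxtrace_mul_neg_part sqr_frobenius_norm /cp_gradient mulmxDl mxtraceD.
rewrite -scalemxAl mxtraceZ.
have -> : \tr (W^T *m mx_neg_part (W *m X) *m X^T)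
    = \tr (mx_neg_part (W *m X) *m (W *m X)^T).
  by rewrite -mulmxA mxtrace_mulC trmx_mul mulmxA.
rewrite trmx_gram_sub1 -(mulmxA _ X) mulmxBr mulmx1 !mxtraceB; ring.
Qed.

(** * Accumulation points of the iterates *)

Lemma entrywise_continuous_gram (R : realType) (m n : nat) :
  entrywise_continuous (fun X : 'M[R]_(m, n) => X *m X^T - 1%:M).
Proof.
have idc : entrywise_continuous (@id 'M[R]_(m, n)).
  by move=> i j; exact: coord_continuous.
apply: entrywise_continuousD; last exact: entrywise_continuous_cst.
by apply: entrywise_continuousM => //; exact: entrywise_continuous_tr.
Qed.

Lemma entrywise_continuous_mul_neg_part (R : realType) (n r rp : nat)
    (W : 'M[R]_(n, r)) :
  entrywise_continuous (fun X : 'M[R]_(r, rp) => mx_neg_part (W *m X)).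
Proof.
apply: entrywise_continuous_neg_part; apply: entrywise_continuousM.
  exact: entrywise_continuous_cst.
by move=> i j; exact: coord_continuous.
Qed.

Lemma entrywise_continuous_cp_gradient (R : realType) (n r rp : nat)
    (W : 'M[R]_(n, r)) (lambda : R) :
  entrywise_continuous (@cp_gradient R n r rp W lambda).
Proof.
apply: entrywise_continuousD.
  apply: entrywise_continuousM; first exact: entrywise_continuous_gram.
  by move=> i j; exact: coord_continuous.
apply: entrywise_continuousZ; apply: entrywise_continuousM.
  exact: entrywise_continuous_cst.
exact: entrywise_continuous_mul_neg_part.
Qed.

(** For each fixed [v], [Y |-> |Y v|] is continuous and bounded by the spectral
    norm on the unit ball, so the bound [1 + e] passes to the limit; the general
    vector is reached by homogeneity. *)
Lemma cluster_contraction (R : realType) (m n : nat) (X : nat -> 'M[R]_(m, n))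
    (Xoo : 'M[R]_(m, n)) :
  (limn_esup (fun k => (spectral_norm (X k))%:E) <= 1%:E)%E ->
  cluster (X @ \oo) Xoo ->
  forall v : 'cV[R]_n, \tr ((Xoo *m v) *m (Xoo *m v)^T) <= \tr (v *m v^T).
Proof.
move=> limsupX Xoo_acc v.
have unit_ball (w : 'cV[R]_n) : \tr (w *m w^T) <= 1 -> frobenius_norm (Xoo *m w) <= 1.
  move=> w1; apply/ler_addgt0Pr => e e0.
  apply: (@cluster_le _ _ (X @ \oo) (fun Y => frobenius_norm (Y *m w))) => //.
    apply: continuous_frobenius_norm; apply: entrywise_continuousM.
      by move=> i j; exact: coord_continuous.
    exact: entrywise_continuous_cst.
  suff : \forall k \near \oo, frobenius_norm (X k *m w) <= 1 + e by [].
  near=> k.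
  apply: (le_trans (frobenius_norm_mulmx_le_spectral_norm _ w1)).
  by apply: ltW; near: k; exact: near_lt_of_limn_esup_le.
rewrite -!sqr_frobenius_norm ler_pXn2r ?nnegrE ?frobenius_norm_ge0//.
apply/ler_addgt0Pr => e e0.
(* The slack [e] keeps the scaling factor nonzero when [v = 0]. *)
set N := frobenius_norm v + e.
have N0 : 0 < N by rewrite ltr_wpDl// frobenius_norm_ge0.
have N_inv_ge0 : 0 <= N^-1 by rewrite invr_ge0 ltW.
have := unit_ball (N^-1 *: v).
rewrite -frobenius_norm_le1 -scalemxAr !(frobenius_normZ _ N_inv_ge0).
rewrite !ler_pdivrMl// !mulr1; apply.
by rewrite lerDl ltW.
Unshelve. all: by end_near. Qed.

Theorem theorem3 (R : realType) (n r rp : nat) (A : 'M[R]_n)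
    (cpA : completely_positive A) (rankA : r = \rank A)
    (W : 'M[R]_(n, r)) (rankW : \rank W = r) (AW : A = W *m W^T)
    (cp_rank_le : (cp_rank cpA <= rp)%N)
    (lambda : R) (lambda_gt0 : 0 < lambda)
    (X : nat -> 'M[R]_(r, rp))
    (f_descending : forall k,
       cp_objective W lambda (X k.+1) <= cp_objective W lambda (X k))
    (grad_cvg0 :
       (fun k => mx_gradient (cp_objective W lambda) (X k)) @ \oo
         --> (0 : 'M[R]_(r, rp)))
    (limsup_le1 :
       (limn_esup (fun k => (spectral_norm (X k))%:E) <= 1%:E)%E)
    (alpha : R) (alpha_gt0 : 0 < alpha) (alpha_lt1 : alpha < 1)
    (f_lt : forall k, cp_objective W lambda (X k) < alpha ^+ 2 / 4)
    (residual_le : \forall k \near \oo,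
       lambda * frobenius_norm (mx_neg_part (W *m X k)) ^+ 2 <=
         alpha * frobenius_norm (X k *m (X k)^T - 1%:M)
         - frobenius_norm (X k *m (X k)^T - 1%:M) ^+ 2)
    (Xoo : 'M[R]_(r, rp)) (Xoo_acc : cluster (X @ \oo) Xoo) :
  global_minimizer (cp_objective W lambda) Xoo.
Proof.
have gradE k : mx_gradient (cp_objective W lambda) (X k)
    = cp_gradient W lambda (X k) by exact: mx_gradient_cp_objective.
rewrite (eq_fun gradE) in grad_cvg0.
have grad0 : cp_gradient W lambda Xoo = 0.
  apply/matrixP => i j; rewrite [RHS]mxE; apply/normr0_eq0/eqP.
  rewrite eq_le normr_ge0 andbT; apply/ler_addgt0Pr => e e0; rewrite add0r.
  apply: (@cluster_le _ _ (X @ \oo)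
    (fun Y => `|cp_gradient W lambda Y i j|)) => //.
    move=> Y.
    exact: (cvg_norm (@entrywise_continuous_cp_gradient _ _ _ rp W lambda i j Y)).
  suff : \forall k \near \oo, `|cp_gradient W lambda (X k) i j| <= e by [].
  apply: cvgr0_norm_le => //.
  have := cvg_comp _ _ grad_cvg0 (@coord_continuous _ _ _ i j 0).
  by rewrite mxE.
have residual_limit : lambda * frobenius_norm (mx_neg_part (W *m Xoo)) ^+ 2
    - alpha * frobenius_norm (Xoo *m Xoo^T - 1%:M)
    + frobenius_norm (Xoo *m Xoo^T - 1%:M) ^+ 2 <= 0.
  apply: (@cluster_le _ _ (X @ \oo)
    (fun Y => lambda * frobenius_norm (mx_neg_part (W *m Y)) ^+ 2
      - alpha * frobenius_norm (Y *m Y^T - 1%:M)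
      + frobenius_norm (Y *m Y^T - 1%:M) ^+ 2)) => //.
    move=> Y.
    have dN := continuous_frobenius_norm
      (@entrywise_continuous_mul_neg_part _ _ _ rp W) (x := Y).
    have dE := continuous_frobenius_norm
      (@entrywise_continuous_gram R r rp) (x := Y).
    exact: (cvgD (cvgB (cvgM (cvg_cst lambda) (cvgM dN dN))
      (cvgM (cvg_cst alpha) dE)) (cvgM dE dE)).
  suff : \forall k \near \oo, lambda * frobenius_norm (mx_neg_part (W *m X k)) ^+ 2
    - alpha * frobenius_norm (X k *m (X k)^T - 1%:M)
    + frobenius_norm (X k *m (X k)^T - 1%:M) ^+ 2 <= 0 by [].
  by apply: filterS residual_le => k; lra.
have := mxtrace_cp_gradient W lambda Xoo.
have := frobenius_norm_le_mxtrace_1B (cluster_contraction limsup_le1 Xoo_acc).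
rewrite grad0 mul0mx mxtrace0 => trace_ge stationary Y.
have delta_ge0 := frobenius_norm_ge0 (Xoo *m Xoo^T - 1%:M).
have neg_ge0 : 0 <= lambda * frobenius_norm (mx_neg_part (W *m Xoo)) ^+ 2.
  by rewrite mulr_ge0 ?sqr_ge0// ltW.
have delta0 : frobenius_norm (Xoo *m Xoo^T - 1%:M) = 0.
  (* [delta <= \tr (1 - Xoo Xoo^T) = delta^2 + neg <= alpha * delta], [alpha < 1]. *)
  by apply/eqP; rewrite eq_le delta_ge0 andbT; nra.
have -> : cp_objective W lambda Xoo = 0.
  move: residual_limit neg_ge0; rewrite /cp_objective delta0; lra.
by rewrite /cp_objective addr_ge0// mulr_ge0 ?sqr_ge0 ?invr_ge0// divr_ge0// ltW.
Qed.
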